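(* Let $a<\theta_0<b$ and $\pi\in(0,1)$. Then the functions $$n\mapsto\mathbb{P}_{n,\pi}(\Theta\le a)\qquad\text{and}\qquad n\mapsto\mathbb{P}_{n,\pi}(\Theta>b),\qquad n\in\mathbb{N}_0,$$ are decreasing (in the weak sense, i.e. non-increasing).
   Context: $\mathbb{N}_0=\{0,1,2,\dots\}$. Let $\nu$ be a nonzero $\sigma$-finite measure on $\mathbb{R}$. Define $B(u)=\log\int_{\mathbb{R}}e^{ux}\,\nu(dx)$, $N=\{u\in\mathbb{R}:\int_{\mathbb{R}}e^{ux}\,\nu(dx)<\infty\}$ (an interval), and let $N^\circ$ be the interior of $N$. Let $\mu$ (the prior distribution) be a probability measure concentrated on $N^\circ$, with support $S$. Fix $\theta_0\in\mathbb{R}$ and set $S^+=S\cap(\theta_0,\infty)$, $S^-=S\cap(-\infty,\theta_0]$. Assume $0<\mu(S^+)<1$, and that $\int_S e^{uy-nB(u)}\,\mu(du)<\infty$ for all $n\in\mathbb{N}_0$ and $y\in\mathbb{R}$. For $n\in\mathbb{N}_0$, $y\in\mathbb{R}$ put $$q(n,y)=\frac{\int_{S^+}e^{uy-nB(u)}\mu(du)}{\int_{S}e^{uy-nB(u)}\mu(du)},\qquad \mu_{n,y}(du)=\frac{e^{uy-nB(u)}\mu(du)}{\int_{S}e^{vy-nB(v)}\mu(dv)}.$$ For each $n$, $y\mapsto q(n,y)$ is an increasing bijection $\mathbb{R}\to(0,1)$; for $\pi\in(0,1)$, $y(n,\pi)$ denotes the unique value with $q(n,y(n,\pi))=\pi$.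 Under $\mathbb{P}_{n,\pi}$ the random variable $\Theta$ has distribution $\mu_{n,y(n,\pi)}$; thus $\mathbb{P}_{n,\pi}(\Theta\in A)=\mu_{n,y(n,\pi)}(A)$ for Borel sets $A\subseteq\mathbb{R}$. *)

(* Defs.v *)
From HB Require Import structures.
From mathcomp Require Import all_boot all_order all_algebra.
From mathcomp Require Import all_classical all_reals all_analysis.
Import Order.TTheory GRing.Theory Num.Theory.
Import numFieldNormedType.Exports.

Set Implicit Arguments.
Unset Strict Implicit.
Unset Printing Implicit Defensive.

Local Open Scope classical_set_scope.
Local Open Scope ring_scope.
Local Open Scope ereal_scope.

Definition mgf (R : realType)
    (nu : {measure set (measurableTypeR R) -> \bar R}) (u : R) : \bar R :=
  \int[nu]_x (expR (u * (x : R)))%:E.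

(* B is extended-real valued: B u = +oo outside [natural_domain nu]. *)
Definition log_mgf (R : realType)
    (nu : {measure set (measurableTypeR R) -> \bar R}) (u : R) : \bar R :=
  lne (mgf nu u).

Definition natural_domain (R : realType)
    (nu : {measure set (measurableTypeR R) -> \bar R}) : set R :=
  [set u | mgf nu u < +oo].

Definition msupport (R : realType)
    (mu : {measure set (measurableTypeR R) -> \bar R}) : set R :=
  [set u | forall U : set R, open U -> U u -> 0 < mu U].

Definition support_gt (R : realType)
    (mu : {measure set (measurableTypeR R) -> \bar R}) (theta0 : R) : set R :=
  msupport mu `&` [set u | (theta0 < u)%R].

(* e^(u y - n B(u)). Where B u = +oo this is 0 for n > 0, and e^(u y) for n = 0
   because 0 * +oo = 0 in \bar R; a prior concentrated on the interior of the
   natural domain does not charge such points. *)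
Definition weight (R : realType)
    (nu : {measure set (measurableTypeR R) -> \bar R})
    (n : nat) (y u : R) : \bar R :=
  expeR ((u * y)%:E - n%:R%:E * log_mgf nu u).

Definition post_gt (R : realType)
    (nu mu : {measure set (measurableTypeR R) -> \bar R}) (theta0 : R)
    (n : nat) (y : R) : R :=
  (fine (\int[mu]_(u in support_gt mu theta0) weight nu n y u) /
   fine (\int[mu]_(u in msupport mu) weight nu n y u))%R.

Definition posterior (R : realType)
    (nu mu : {measure set (measurableTypeR R) -> \bar R})
    (n : nat) (y : R) (A : set R) : R :=
  (fine (\int[mu]_(u in A) weight nu n y u) /
   fine (\int[mu]_(v in msupport mu) weight nu n y v))%R.

(* The value y(n, p): the y with q(n, y) = p (default 0 if there were none). *)
Definition y_of (R : realType)
    (nu mu : {measure set (measurableTypeR R) -> \bar R}) (theta0 : R)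
    (n : nat) (p : R) : R :=
  xget 0%R [set y | post_gt nu mu theta0 n y = p].

(* P_{n,p}(Theta \in A) *)
Definition prob_Theta (R : realType)
    (nu mu : {measure set (measurableTypeR R) -> \bar R}) (theta0 : R)
    (n : nat) (p : R) (A : set R) : R :=
  posterior nu mu n (y_of nu mu theta0 n p) A.

(* Main.v *)
Require Import Defs.
From HB Require Import structures.
From mathcomp Require Import all_boot all_order all_algebra.
From mathcomp Require Import all_classical all_reals all_analysis measurable_realfun.
From mathcomp Require Import ring lra.
Import Order.TTheory GRing.Theory Num.Theory.
Import numFieldNormedType.Exports.
Local Open Scope classical_set_scope.
Local Open Scope ring_scope.

(* Let q(m, y) = q(n, z) = p with m <= n, and let f, g be the normalised
   densities of the two posteriors with respect to mu. Up to a constant factor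
   g / f is exp(u (z - y) - (n - m) B(u)), which is log-concave because B is
   convex; so {f <= g} is an interval. On each side of theta0 the densities f and
   g have the same mass, hence the interval meets both sides, and within each
   side g - f changes sign at most once, being negative in the outer part.
   Therefore g has the lighter tails. *)

(** * Comparison of real-valued integrals *)

Lemma Rintegral_setID {d : measure_display} {T : measurableType d}
    {R : realType} (mu : {measure set T -> \bar R}) (A B : set T) (f : T -> R) :
  measurable A -> measurable B -> mu.-integrable A (EFin \o f) ->
  \int[mu]_(x in A) f x =
  \int[mu]_(x in A `&` B) f x + \int[mu]_(x in A `\` B) f x.
Proof.
move=> mA mB fA; rewrite -[in LHS](setUIDK A B) Rintegral_setU ?setUIDK//.
- exact: measurableI.
- exact: measurableD.
- by apply/disj_setPS => x [[_ ?] [_]].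
Qed.

Lemma Rintegral_setI_conull {d : measure_display} {T : measurableType d}
    {R : realType} (mu : {measure set T -> \bar R}) (A D : set T) (f : T -> R) :
  measurable A -> measurable D -> mu (~` D) = 0%E ->
  measurable_fun A f -> (forall x, A x -> 0 <= f x) ->
  \int[mu]_(x in A) f x = \int[mu]_(x in A `&` D) f x.
Proof.
move=> mA mD D0 mf f0; rewrite /Rintegral.
by rewrite (ge0_negligible_integral (measurableC mD)) ?setDE ?setCK//;
  exact/measurable_EFinP.
Qed.

(** A vanishing integral of a nonnegative function forces [f = 0] almost everywhere on [A]; as [f]
    has no zero there, [A] would be null. *)
Lemma Rintegral_gt0 {d : measure_display} {T : measurableType d}
    {R : realType} (mu : {measure set T -> \bar R}) (A : set T) (f : T -> R) :
  measurable A -> mu.-integrable A (EFin \o f) -> (0 < mu A)%E ->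
  (forall x, A x -> 0 < f x) -> 0 < \int[mu]_(x in A) f x.
Proof.
move=> mA fA A0 f0; have mf := measurable_int _ fA.
rewrite lt0r Rintegral_ge0 ?andbT; last by move=> x /f0/ltW.
apply/negP => /eqP If0.
have : (\int[mu]_(x in A) `|(f x)%:E| = 0)%E.
  rewrite (eq_integral (EFin \o f)); last first.
    by move=> x /set_mem /f0 fx; rewrite /= ger0_norm// ltW.
  by rewrite -[LHS]fineK ?integrable_fin_num//; congr EFin.
move/(ae_eq_integral_abs mu mA mf) => [N [mN N0 AN]].
have : (mu A <= mu N)%E.
  apply: le_measure; rewrite ?inE// => x Ax; apply: AN => /= /(_ Ax)[fx0].
  by have := f0 x Ax; rewrite fx0 ltxx.
by rewrite N0 leNgt A0.
Qed.

Lemma Rintegral_lt {d : measure_display} {T : measurableType d}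
    {R : realType} (mu : {measure set T -> \bar R}) (A : set T) (f g : T -> R) :
  measurable A -> mu.-integrable A (EFin \o f) ->
  mu.-integrable A (EFin \o g) -> (0 < mu A)%E ->
  (forall x, A x -> f x < g x) ->
  \int[mu]_(x in A) f x < \int[mu]_(x in A) g x.
Proof.
move=> mA fA gA A0 fg; rewrite -subr_gt0 -RintegralB//.
apply: Rintegral_gt0 => // [|x /fg]; last by rewrite subr_gt0.
exact: (integrableB mA gA fA).
Qed.

(** Otherwise [g < f] on a set of positive measure and the integrals would differ. This produces a
    point of [f <= g] on each side of [theta0]. *)
Lemma exists_ge_of_Rintegral_eq {d : measure_display} {T : measurableType d}
    {R : realType} (mu : {measure set T -> \bar R}) (A : set T) (f g : T -> R) :
  measurable A -> mu.-integrable A (EFin \o f) ->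
  mu.-integrable A (EFin \o g) -> (0 < mu A)%E ->
  \int[mu]_(x in A) f x = \int[mu]_(x in A) g x ->
  exists2 x, A x & f x <= g x.
Proof.
move=> mA fA gA A0 fg; apply: contrapT => /forall2NP h.
suff : \int[mu]_(x in A) g x < \int[mu]_(x in A) f x by rewrite fg ltxx.
by apply: Rintegral_lt => // x Ax; case: (h x) => // /negP; rewrite -ltNge.
Qed.

(** [A] is the outer part of a side [L]. Either [g < f] on all of [A], or [f <= g] on the rest of
    [L]; in the second case [g] has at least as much mass as [f] on the rest, and the equal totals
    over [L] leave it at most as much on [A]. *)
Lemma le_Rintegral_crossing {d : measure_display} {T : measurableType d}
    {R : realType} (mu : {measure set T -> \bar R}) (L A : set T) (f g : T -> R) :
  measurable L -> measurable A -> A `<=` L ->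
  mu.-integrable L (EFin \o f) -> mu.-integrable L (EFin \o g) ->
  \int[mu]_(x in L) f x = \int[mu]_(x in L) g x ->
  ((exists2 x, A x & f x <= g x) -> forall x, (L `\` A) x -> f x <= g x) ->
  \int[mu]_(x in A) g x <= \int[mu]_(x in A) f x.
Proof.
move=> mL mA AL fL gL fg cross.
have mLA : measurable (L `\` A) by exact: measurableD.
have [fA gA] : mu.-integrable A (EFin \o f) /\ mu.-integrable A (EFin \o g).
  by split; apply: (integrableS mL).
have [/cross le_fg|/forall2NP lt_gf] := pselect (exists2 x, A x & f x <= g x).
  have : \int[mu]_(x in L `\` A) f x <= \int[mu]_(x in L `\` A) g x.
    by apply: le_Rintegral => //; apply: (integrableS mL).
  move: fg; rewrite !(Rintegral_setID mu L A)// setIidr//; lra.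
apply: le_Rintegral => // x Ax.
by case: (lt_gf x) => // /negP; rewrite -ltNge => /ltW.
Qed.

(** * Existence of [y] with prescribed odds: exponential tilts and the intermediate value theorem *)

(** [A] and [B] model the unnormalised masses above and below [theta0]. The difference [F] is
    negative far to the left, where [A] is small and [B] is at least [B 0]. It is positive far to
    the right: the inequality in [c] turns smallness of [A (- y)] into largeness of [A y], while [B]
    is at most [B 0]. *)
Lemma exists_balance {R : realType} (A B : R -> R) (p : R) :
  continuous A -> continuous B ->
  (forall e, 0 < e -> exists2 y, 0 <= y & A (- y) < e) ->
  (forall c y, 2 * c * A 0 <= A y + c ^+ 2 * A (- y)) ->
  {homo B : y z / y <= z >-> z <= y} ->
  0 < A 0 -> 0 < B 0 -> 0 < p < 1 ->
  exists y, (1 - p) * A y = p * B y.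
Proof.
move=> cA cB A_small A_AMGM B_le A0 B0 /andP[p0 p1].
have q0 : 0 < 1 - p by lra.
pose F y := (1 - p) * A y - p * B y.
have cF : continuous F.
  move=> y; apply: cvgB; (apply: cvgM; first exact: cvg_cst).
    exact: cA.
  exact: cB.
have pB : 0 < p * B 0 / (1 - p) by rewrite divr_gt0 ?mulr_gt0.
have [y1 y10 Fy1] : exists2 y, 0 <= y & F (- y) < 0.
  have [y y0 Ay] := A_small _ pB.
  exists y => //; rewrite /F subr_lt0.
  apply: (@lt_le_trans _ _ (p * B 0)).
    by rewrite mulrC -ltr_pdivlMr.
  by rewrite ler_pM2l// B_le// oppr_le0.
have [y2 y20 Fy2] : exists2 y, 0 <= y & 0 < F y.
  (* With this [c], [2 * c * A 0] exceeds the target [p * B 0 / (1 - p)] by exactly 1, and the bound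
     [A (- y) < c ^- 2] makes the loss [c ^+ 2 * A (- y)] less than 1. *)
  pose c := (p * B 0 / (1 - p) + 1) / (2 * A 0).
  have c0 : 0 < c by rewrite divr_gt0 ?mulr_gt0 ?addr_gt0.
  have [|y y0 Ay] := A_small (c ^- 2).
    by rewrite invr_gt0 exprn_gt0.
  exists y => //; rewrite /F subr_gt0.
  apply: (@le_lt_trans _ _ (p * B 0)).
    by rewrite ler_pM2l// B_le.
  rewrite [ltRHS]mulrC -ltr_pdivrMr//.
  have := A_AMGM c y.
  have -> : 2 * c * A 0 = p * B 0 / (1 - p) + 1.
    by rewrite mulrAC /c mulrC divfK// mulf_neq0// gt_eqF.
  have : c ^+ 2 * A (- y) < 1.
    by rewrite mulrC -ltr_pdivlMr ?exprn_gt0// div1r.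
  lra.
have y12 : - y1 <= y2 by lra.
have [||y _ Fy] := @IVT _ F (- y1) y2 0 y12.
- exact: continuous_subspaceT.
- by rewrite ge_min le_max (ltW Fy1) (ltW Fy2) orbT.
by exists y; apply/eqP; rewrite -subr_eq0; apply/eqP.
Qed.

Section exponential_tilting.
Context {d : measure_display} {T : measurableType d} {R : realType}.
Context (mu : {measure set T -> \bar R}).
Implicit Types (U V : set T) (phi rho : T -> R).

(** A Laplace transform of [rho] in the statistic [phi]. It is applied with [phi u = u - theta0],
    whose sign tells the two sides of [theta0] apart. *)
Definition tilt phi rho U y : R := \int[mu]_(u in U) (expR (phi u * y) * rho u).

(** Dominated convergence near [y]: for [z] between [- K] and [K] the integrand is at most its value
    at [K] or at [- K], according to the sign of [phi u], hence at most their sum. *)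
Lemma continuous_tilt phi rho U :
  measurable U -> (forall u, U u -> 0 <= rho u) ->
  (forall y, mu.-integrable U (EFin \o (fun u => expR (phi u * y) * rho u))) ->
  continuous (tilt phi rho U).
Proof.
move=> mU rho0 int y.
pose K := `|y| + 1.
have yK : y \in `]- K, K[.
  by rewrite in_itv/= -ltr_norml /K ltrDl.
apply: (@continuity_under_integral _ _ _ mu
  (fun y u => expR (phi u * y) * rho u) U mU (- K) K _ _
  (fun u => expR (phi u * K) * rho u + expR (phi u * - K) * rho u)) => //.
- apply: aeW => u Uu z _.
  apply: cvgM; last exact: cvg_cst.
  apply: continuous_comp; last exact: continuous_expR.
  by apply: cvgM; [exact: cvg_cst|exact: cvg_id].
- exact: (@integrableD _ _ _ mu _ mU _ _ (int K) (int (- K))).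
- move=> z; rewrite /= in_itv/= => /andP[Kz zK]; apply: aeW => u Uu.
  rewrite ger0_norm ?mulr_ge0 ?expR_ge0 ?rho0// -mulrDl ler_wpM2r ?rho0//.
  have [u0|u0] := leP 0 (phi u).
    by rewrite ler_wpDr ?expR_ge0// ler_expR ler_wpM2l// ltW.
  by rewrite ler_wpDl ?expR_ge0// ler_expR ler_wnM2l// ltW.
- exact: mem_set.
Qed.

(** Dominated convergence along the integers: at [- k] the integrand is [rho u] times the [k]-th
    power of [expR (- phi u) < 1], and the term [k = 0] dominates. *)
Lemma tilt_small phi rho U (e : R) :
  measurable U -> (forall u, U u -> 0 <= rho u) ->
  (forall y, mu.-integrable U (EFin \o (fun u => expR (phi u * y) * rho u))) ->
  (forall u, U u -> 0 < phi u) -> 0 < e ->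
  exists2 y, 0 <= y & tilt phi rho U (- y) < e.
Proof.
move=> mU rho0 int phi0 e0.
pose F (k : nat) u := (expR (phi u * - k%:R) * rho u)%:E.
have [|||||_ _] := @dominated_convergence _ _ _ mu U mU F (cst 0%E) (F 0%N).
- by move=> k; apply: measurable_int (int (- k%:R)).
- exact: measurable_cst.
- apply: aeW => u Uu; rewrite /F.
  apply: cvg_EFin; first exact: nearW.
  rewrite -[X in _ --> X](mul0r (rho u)).
  apply: cvgM; last exact: cvg_cst.
  rewrite (_ : (fun _ => _) = GRing.exp (expR (- phi u))); last first.
    by apply/funext => k; rewrite mulrN -mulNr expRM_natr.
  apply: cvg_expr; rewrite ger0_norm ?expR_ge0// -expR0 ltr_expR.
  by rewrite oppr_lt0 phi0.
- exact: int.
- apply: aeW => u k Uu; rewrite lee_fin ger0_norm ?mulr_ge0 ?expR_ge0 ?rho0//.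
  rewrite ler_wpM2r ?rho0// ler_expR mulrN oppr0 mulr0 oppr_le0.
  by rewrite mulr_ge0// ltW// phi0.
rewrite integral0 => /fine_cvg /cvgr_lt /(_ _ e0)[k _ /(_ k (leqnn k)) ke].
by exists k%:R.
Qed.

Lemma tilt_le phi rho V y z :
  measurable V -> (forall u, V u -> 0 <= rho u) ->
  (forall y, mu.-integrable V (EFin \o (fun u => expR (phi u * y) * rho u))) ->
  (forall u, V u -> phi u <= 0) -> y <= z ->
  tilt phi rho V z <= tilt phi rho V y.
Proof.
move=> mV rho0 int phi0 yz; apply: le_Rintegral => // u Vu.
by rewrite ler_wpM2r ?rho0// ler_expR ler_wnM2l// phi0.
Qed.

(* [e + c^2 / e >= 2 c] pointwise: smallness of the tilt at [- y] forces
   largeness at [y]. *)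
Lemma tilt_AMGM phi rho U (c y : R) :
  measurable U -> (forall u, U u -> 0 <= rho u) ->
  (forall y, mu.-integrable U (EFin \o (fun u => expR (phi u * y) * rho u))) ->
  2 * c * tilt phi rho U 0 <= tilt phi rho U y + c ^+ 2 * tilt phi rho U (- y).
Proof.
move=> mU rho0 int.
have intZ k z :
    mu.-integrable U (EFin \o (fun u => k * (expR (phi u * z) * rho u))).
  exact: (integrableZl mU k (int z)).
rewrite /tilt -!RintegralZl// -RintegralD//.
apply: le_Rintegral => //.
  exact: (integrableD mU (int y) (intZ (c ^+ 2) (- y))).
move=> u Uu; rewrite mulr0 expR0 mul1r mulrA -mulrDl ler_wpM2r ?rho0//.
have := expRxMexpNx_1 (phi u * y); rewrite mulrN.
have := expR_gt0 (- (phi u * y)).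
set E := expR (phi u * y); set E' := expR _ => E'0 EE'.
have -> : E + c ^+ 2 * E' = 2 * c + E' * (E - c) ^+ 2.
  have EEE : E' * E ^+ 2 = E by rewrite expr2 mulrA [E' * _]mulrC EE' mul1r.
  have -> : E' * (E - c) ^+ 2 = E' * E ^+ 2 - 2 * c * (E * E') + c ^+ 2 * E'.
    by ring.
  by rewrite EEE EE'; ring.
by rewrite lerDl mulr_ge0 ?sqr_ge0// ltW.
Qed.

Lemma exists_tilt_ratio phi rho U V (p : R) :
  measurable U -> measurable V ->
  (forall u, U u -> 0 <= rho u) -> (forall u, V u -> 0 <= rho u) ->
  (forall y, mu.-integrable U (EFin \o (fun u => expR (phi u * y) * rho u))) ->
  (forall y, mu.-integrable V (EFin \o (fun u => expR (phi u * y) * rho u))) ->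
  (forall u, U u -> 0 < phi u) -> (forall u, V u -> phi u <= 0) ->
  0 < tilt phi rho U 0 -> 0 < tilt phi rho V 0 -> 0 < p < 1 ->
  exists y, (1 - p) * tilt phi rho U y = p * tilt phi rho V y.
Proof.
move=> mU mV rhoU rhoV intU intV phiU phiV U0 V0 p01.
apply: (exists_balance (tilt phi rho U) (tilt phi rho V)) => //.
- exact: continuous_tilt.
- exact: continuous_tilt.
- by move=> e e0; exact: tilt_small.
- by move=> c y; exact: tilt_AMGM.
- by move=> y z yz; exact: tilt_le.
Qed.

End exponential_tilting.

(** * Convexity of the log-Laplace transform *)

(** The tangent of the exponential at the mean [w] lies below its graph; averaging this bound at [a]
    and [b] cancels the linear terms. *)
Lemma le_expR_convex {R : realType} (l a b : R) : 0 <= l <= 1 ->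
  expR (l * a + (1 - l) * b) <= l * expR a + (1 - l) * expR b.
Proof.
move=> /andP[l0 l1].
have ew (w z : R) : expR w * (1 + (z - w)) <= expR z.
  rewrite -[z in leRHS](subrKC w) expRD ler_wpM2l ?expR_ge0//.
  exact: expR_ge1Dx.
set w := l * a + _.
have m0 : 0 <= 1 - l by rewrite subr_ge0.
have := lerD (ler_wpM2l l0 (ew w a)) (ler_wpM2l m0 (ew w b)).
apply: le_trans; set E := expR w.
by rewrite le_eqVlt; apply/orP; left; apply/eqP; rewrite /w; ring.
Qed.

Lemma mgf_gt0 {R : realType} (nu : {measure set (measurableTypeR R) -> \bar R})
    (u : R) : nu setT != 0%E -> (0 < mgf nu u)%E.
Proof.
move=> nu0; rewrite lt0e integral_ge0 ?andbT; last first.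
  by move=> x _; rewrite lee_fin expR_ge0.
apply: contra nu0 => /eqP mgf0.
have mf : measurable_fun [set: measurableTypeR R] (fun x => (expR (u * x))%:E).
  apply/measurable_EFinP; exact: measurableT_comp.
have : (\int[nu]_(x in setT) `|(expR (u * (x : R)))%:E| = 0)%E.
  by rewrite -[RHS]mgf0; apply: eq_integral => x _; rewrite gee0_abs// lee_fin expR_ge0.
move/(ae_eq_integral_abs nu measurableT mf) => [N [mN N0 NT]].
rewrite -measure_le0 -N0 le_measure ?inE// => x _; apply: NT => /= /(_ Logic.I)[].
by apply/eqP; rewrite gt_eqF ?expR_gt0.
Qed.

(** [mgf nu] is a partial integral of a jointly measurable function, so Tonelli's theorem applies;
    it uses the sigma-finiteness of [nu]. *)
Lemma measurable_mgf {R : realType}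
    (nu : {sigma_finite_measure set (measurableTypeR R) -> \bar R}) :
  measurable_fun setT (mgf nu).
Proof.
apply: (@measurable_fun_fubini_tonelli_F _ _ (measurableTypeR R)
  (measurableTypeR R) R nu (fun z => (expR (z.1 * z.2))%:E)).
  apply/measurable_EFinP; apply: measurableT_comp => //.
  by apply: measurable_funM; [exact: measurable_fst|exact: measurable_snd].
by move=> z; rewrite lee_fin expR_ge0.
Qed.

Lemma measurable_natural_domain {R : realType}
    (nu : {sigma_finite_measure set (measurableTypeR R) -> \bar R}) :
  measurable (natural_domain nu : set (measurableTypeR R)).
Proof.
rewrite -[natural_domain nu]setTI.
by apply: emeasurable_fun_infty_o => //; exact: measurable_mgf.
Qed.

(** The shifts [c - a] and [c - b] have weighted mean zero, so this is convexity of the exponential.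
    It is the pointwise form of Hölder's inequality, with [a] and [b] to be the logarithms of the
    two transforms. *)
Lemma le_expR_chord {R : realType} (l x z s a b c : R) : 0 <= l <= 1 ->
  c = l * a + (1 - l) * b ->
  expR ((l * x + (1 - l) * z) * s) <=
  l * expR (c - a) * expR (x * s) + (1 - l) * expR (c - b) * expR (z * s).
Proof.
move=> l01 ->; rewrite -!mulrA -!expRD.
apply: le_trans (le_expR_convex _ _ _ l01).
by rewrite ler_expR le_eqVlt; apply/orP; left; apply/eqP; ring.
Qed.

Lemma chord_mean {R : realType} (l c X Z : R) : 0 < X -> 0 < Z ->
  l * expR (c - ln X) * X + (1 - l) * expR (c - ln Z) * Z = expR c.
Proof.
move=> X0 Z0; rewrite !expRB !lnK ?posrE//.
by set e := expR c; field; rewrite !gt_eqF.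
Qed.

Lemma mgf_le_chord {R : realType} (nu : {measure set (measurableTypeR R) -> \bar R})
    (l x z X Z : R) :
  0 <= l <= 1 -> 0 < X -> 0 < Z -> mgf nu x = X%:E -> mgf nu z = Z%:E ->
  (mgf nu (l * x + (1 - l) * z) <= (expR (l * ln X + (1 - l) * ln Z))%:E)%E.
Proof.
move=> l01 X0 Z0 mX mZ; set c := l * ln X + _.
have /andP[l0 l1] := l01; have m0 : 0 <= 1 - l by rewrite subr_ge0.
have me (u : R) : measurable_fun [set: measurableTypeR R]
    (fun s : measurableTypeR R => (expR (u * s))%:E).
  by apply/measurable_EFinP; exact: measurableT_comp.
have meZ (k u : R) : measurable_fun [set: measurableTypeR R]
    (fun s : measurableTypeR R => (k * expR (u * s))%:E).
  by apply/measurable_EFinP/measurable_funM => //; exact: measurableT_comp.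
pose A := l * expR (c - ln X); pose B := (1 - l) * expR (c - ln Z).
have A0 : 0 <= A by rewrite mulr_ge0// expR_ge0.
have B0 : 0 <= B by rewrite mulr_ge0// expR_ge0.
(* Each normalised transform contributes its share [l] or [1 - l] of [expR c]; written as one
   integral, the bound follows by integrating [le_expR_chord]. *)
have -> : (expR c)%:E = (A%:E * mgf nu x + B%:E * mgf nu z)%E.
  by rewrite mX mZ -!EFinM -EFinD chord_mean.
have mgfZ (k u : R) : 0 <= k ->
    (k%:E * mgf nu u = \int[nu]_s (k * expR (u * (s : R)))%:E)%E.
  by move=> k0; rewrite -(@ge0_integralZl_EFin _ _ _ nu _ measurableT)//.
have -> : (A%:E * mgf nu x + B%:E * mgf nu z =
    \int[nu]_s ((A * expR (x * (s : R)))%:E + (B * expR (z * (s : R)))%:E))%E.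
  rewrite (mgfZ A)// (mgfZ B)// ge0_integralD//.
    by move=> s _; rewrite lee_fin mulr_ge0 ?expR_ge0.
  by move=> s _; rewrite lee_fin mulr_ge0 ?expR_ge0.
apply: ge0_le_integral => //.
  exact: emeasurable_funD.
move=> s _; rewrite -EFinD lee_fin.
exact: le_expR_chord.
Qed.

Section laplace_transform.
Context {R : realType} (nu : {measure set (measurableTypeR R) -> \bar R}).
Context (nu_neq0 : nu setT != 0%E).

Definition rmgf u : R := fine (mgf nu u).
Local Notation M := rmgf.

Lemma rmgf_ge0 u : 0 <= M u.
Proof. by apply: fine_ge0; apply: integral_ge0 => x _; rewrite lee_fin expR_ge0. Qed.

Lemma natural_domainP u : natural_domain nu u -> mgf nu u = (M u)%:E.
Proof. by move=> Nu; rewrite fineK// ge0_fin_numE// ltW// mgf_gt0. Qed.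

Lemma fine_mgf_gt0 u : natural_domain nu u -> 0 < M u.
Proof. by move=> Nu; rewrite -lte_fin -natural_domainP// mgf_gt0. Qed.

(* Also correct where [mgf nu u = +oo], thanks to [fine +oo = 0] and [0^-1 = 0]. *)
Lemma weightE n y u : weight nu n y u = (expR (u * y) * (M u) ^- n)%:E.
Proof.
rewrite /weight /log_mgf /rmgf; have := mgf_gt0 nu u nu_neq0.
case: (mgf nu u) => [r|_|//]; last first.
  rewrite /=; case: n => [|n]; first by rewrite mul0e sube0 expr0 invr1 mulr1.
  by rewrite mulry gtr0_sg// mul1e /= expr0n invr0 mulr0.
rewrite lte_fin => r0; rewrite lne_EFin// -EFinM -EFinB /= expRD; congr (_ * _)%:E.
by rewrite mulrC expRN expRM_natr lnK.
Qed.

(** The finite bound of [mgf_le_chord] does two things: it puts [t] in the natural domain, so the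
    domain is convex, and its logarithm is the convexity of [B]. *)
Lemma log_mgf_convex l x z t : 0 <= l <= 1 ->
  natural_domain nu x -> natural_domain nu z -> t = l * x + (1 - l) * z ->
  natural_domain nu t /\ ln (M t) <= l * ln (M x) + (1 - l) * ln (M z).
Proof.
move=> l01 Nx Nz te.
have := @mgf_le_chord _ nu l x z (M x) (M z) l01 (fine_mgf_gt0 x Nx)
  (fine_mgf_gt0 z Nz) (natural_domainP x Nx) (natural_domainP z Nz).
rewrite -te; set c := l * ln _ + _ => le_mgf.
have Nt : natural_domain nu t by exact: le_lt_trans le_mgf (ltry _).
split=> //; rewrite -(expRK c) ler_ln ?posrE ?expR_gt0 ?fine_mgf_gt0//.
by rewrite -lee_fin -(natural_domainP t Nt).
Qed.

End laplace_transform.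

(** * The topological support of a measure on the line *)

Lemma closed_msupport {R : realType}
    (mu : {measure set (measurableTypeR R) -> \bar R}) :
  closed (msupport mu : set R).
Proof.
rewrite -[msupport mu]setCK; apply: open_closedC; rewrite openE => x.
move=> /existsNP[U /not_implyP[oU /not_implyP[Ux U0]]].
apply: (@filterS _ _ _ U); last exact: open_nbhs_nbhs.
by move=> z Uz Sz; exact/U0/Sz.
Qed.

Lemma measurable_msupport {R : realType}
    (mu : {measure set (measurableTypeR R) -> \bar R}) :
  measurable (msupport mu : set (measurableTypeR R)).
Proof. by apply: closed_measurable; exact: closed_msupport. Qed.

(** Each point off the support has a null neighbourhood, hence lies in a null interval with rational
    endpoints, and there are countably many of these. *)
Lemma msupportC_null {R : realType}
    (mu : {measure set (measurableTypeR R) -> \bar R}) :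
  mu (~` msupport mu) = 0%E.
Proof.
pose I (qr : rat * rat) : set (measurableTypeR R) :=
  [set` `](ratr qr.1 : R), (ratr qr.2 : R)[].
(* Intervals of positive measure and codes of no pair are replaced by [set0], so that every [F k] is
   null. *)
pose F k := if unpickle k is Some qr then
  if mu (I qr) == 0%E then I qr else set0 else set0.
have F0 k : mu.-negligible (F k).
  rewrite /F; case: unpickle => [qr|]; last exact: negligible_set0.
  case: eqP => [I0|_]; last exact: negligible_set0.
  by exists (I qr); split => //; exact: measurable_itv.
have : mu.-negligible (~` msupport mu).
  apply: negligibleS (negligible_bigcup F0).
  move=> x /existsNP[U /not_implyP[oU /not_implyP[Ux /negP]]].
  rewrite lt0e measure_ge0 andbT negbK => /eqP U0.
  have /nbhs_ballP[e /= e0 xeU] : nbhs x U by exact: open_nbhs_nbhs.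
  have [q /[!in_itv]/= /andP[xq qx]] : exists q : rat, ratr q \in `]x - e, x[.
    by apply: rat_in_itvoo; rewrite ltrBlDr ltrDl.
  have [r /[!in_itv]/= /andP[xr rx]] : exists r : rat, ratr r \in `]x, x + e[.
    by apply: rat_in_itvoo; rewrite ltrDl.
  have [k kqr] : exists k, unpickle k = Some (q, r).
    by exists (pickle (q, r)); exact: pickleK.
  exists k => //; rewrite /F kqr.
  have /eqP -> : mu (I (q, r)) == 0%E.
    rewrite -measure_le0 -U0 le_measure ?inE//.
    - exact: measurable_itv.
    - exact: open_measurable.
    move=> z; rewrite /I /= in_itv/= => /andP[qz zr]; apply: xeU => /=.
    rewrite -ball_normE/= distrC ltr_norml; apply/andP; split; lra.
  by rewrite eqxx /I /= in_itv/= qx xr.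
by move/measure_negligible; apply; apply: measurableC; exact: measurable_msupport.
Qed.

(** * Log-concavity of the ratio of two densities *)

(** [X], [W], [T] stand for values of [B] at [x], at [w] and in between: a nonnegative multiple of a
    convex function that is below an affine one at two points stays below it between them. *)
Lemma le_chord {R : realType} (l k X T W x w e c : R) : 0 <= l <= 1 -> 0 <= k ->
  T <= l * X + (1 - l) * W -> k * X <= x * e + c -> k * W <= w * e + c ->
  k * T <= (l * x + (1 - l) * w) * e + c.
Proof.
move=> /andP[l0 l1] k0 TXW hX hW; apply: (le_trans (ler_wpM2l k0 TXW)).
have m0 : 0 <= 1 - l by rewrite subr_ge0.
have := lerD (ler_wpM2l l0 hX) (ler_wpM2l m0 hW).
have -> : l * (k * X) + (1 - l) * (k * W) = k * (l * X + (1 - l) * W) by ring.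
have -> // : l * (x * e + c) + (1 - l) * (w * e + c) =
  (l * x + (1 - l) * w) * e + c by ring.
Qed.

Definition tilted_density {R : realType}
    (nu : {measure set (measurableTypeR R) -> \bar R}) (n : nat) (y u : R) : R :=
  expR (u * y) * rmgf nu u ^- n.

Section log_concave_ratio.
Context {R : realType} (nu : {measure set (measurableTypeR R) -> \bar R}).
Context (nu_neq0 : nu setT != 0%E).

Local Notation M := (rmgf nu).
Local Notation dens := (tilted_density nu).

Lemma tilted_density_gt0 n y u : natural_domain nu u -> 0 < dens n y u.
Proof.
by move=> Nu; rewrite mulr_gt0 ?expR_gt0// invr_gt0 exprn_gt0// fine_mgf_gt0.
Qed.

(** Taking logarithms turns the comparison of normalised densities into a comparison of a multiple
    of [B] with an affine function of [u]; the multiple is nonnegative when [m <= n]. *)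
Lemma le_tilted_density m n y z a b u : natural_domain nu u -> 0 < a -> 0 < b ->
  dens m y u / a <= dens n z u / b <->
  (n%:R - m%:R) * ln (M u) <= u * (z - y) + (ln a - ln b).
Proof.
move=> Nu a0 b0; have Mu := fine_mgf_gt0 nu nu_neq0 u Nu.
have densE k w c : 0 < c ->
    dens k w u / c = expR (u * w - k%:R * ln (M u) - ln c).
  move=> c0; rewrite !expRD !expRN expRM_natl !lnK ?posrE//.
rewrite !densE// ler_expR; move: (ln (M u)) => L.
by rewrite mulrBl mulrBr; split; lra.
Qed.

(* The logarithm of the ratio of two densities is concave on the natural domain. *)
Lemma le_tilted_density_between m n y z a b x t w : (m <= n)%N ->
  0 < a -> 0 < b -> natural_domain nu x -> natural_domain nu w ->
  x <= t -> t <= w ->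
  dens m y x / a <= dens n z x / b -> dens m y w / a <= dens n z w / b ->
  dens m y t / a <= dens n z t / b.
Proof.
move=> mn a0 b0 Nx Nw xt tw.
have [xw|] := ltP x w; last first.
  by move=> wx; have -> : t = x by apply/eqP; rewrite eq_le xt (le_trans tw).
have wx0 : 0 < w - x by rewrite subr_gt0.
pose l := (w - t) / (w - x).
have l01 : 0 <= l <= 1.
  by rewrite divr_ge0 ?subr_ge0 ?(ltW xw)//= ler_pdivrMr// mul1r lerD2l lerN2.
have te : t = l * x + (1 - l) * w.
  by rewrite /l; field; rewrite gt_eqF.
have [Nt MT] := log_mgf_convex nu nu_neq0 l x w t l01 Nx Nw te.
move=> /(le_tilted_density m n y z a b x Nx a0 b0) hx.
move=> /(le_tilted_density m n y z a b w Nw a0 b0) hw.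
apply/(le_tilted_density m n y z a b t Nt a0 b0).
have k0 : 0 <= n%:R - m%:R :> R by rewrite subr_ge0 ler_nat.
by have := le_chord _ _ _ _ _ _ _ _ _ l01 k0 MT hx hw; rewrite -te.
Qed.

End log_concave_ratio.

(** * Measurability of the densities and of half-lines *)

Lemma measurable_tilted_density {R : realType}
    (nu : {sigma_finite_measure set (measurableTypeR R) -> \bar R}) n y :
  measurable_fun [set: measurableTypeR R] (tilted_density nu n y).
Proof.
apply: measurable_funM.
  by apply: measurableT_comp => //; exact: mulrr_measurable.
(* The inverse becomes the real power [-1], a measurable function; the two agree on nonnegative
   reals, including the default value at 0. *)
have -> : (fun u => rmgf nu u ^- n) = (fun u => (rmgf nu u `^ (-1)) ^+ n).
  by apply/funext => u; rewrite powR_inv1 ?exprVn// rmgf_ge0.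
apply: measurable_funX.
apply: (@measurableT_comp _ _ _ _ _ _ (@powR R ^~ (-1))) => //.
by apply: measurableT_comp => //; exact: measurable_mgf.
Qed.

Lemma measurable_gt {R : realType} (x : R) :
  measurable ([set u | x < u] : set (measurableTypeR R)).
Proof. by rewrite -set_itvoy; exact: measurable_itv. Qed.

Lemma measurable_le {R : realType} (x : R) :
  measurable ([set u | u <= x] : set (measurableTypeR R)).
Proof. by rewrite -set_itvNyc; exact: measurable_itv. Qed.

#[local] Hint Resolve measurable_gt measurable_le : core.

(** * Tail comparison for two densities with equal mass on each side *)

Lemma le_Rintegral_tails {R : realType}
    (mu : {measure set (measurableTypeR R) -> \bar R})
    (D : set (measurableTypeR R)) (f g : R -> R) (theta0 : R) :
  measurable D -> mu.-integrable D (EFin \o f) -> mu.-integrable D (EFin \o g) ->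
  (0 < mu ([set u | (u <= theta0)%R] `&` D))%E ->
  (0 < mu ([set u | (theta0 < u)%R] `&` D))%E ->
  \int[mu]_(u in [set u | u <= theta0] `&` D) f u =
    \int[mu]_(u in [set u | u <= theta0] `&` D) g u ->
  \int[mu]_(u in [set u | theta0 < u] `&` D) f u =
    \int[mu]_(u in [set u | theta0 < u] `&` D) g u ->
  (forall s t r, D s -> D r -> s <= t -> t <= r ->
    f s <= g s -> f r <= g r -> f t <= g t) ->
  (forall a, a < theta0 -> \int[mu]_(u in [set u | u <= a] `&` D) g u <=
    \int[mu]_(u in [set u | u <= a] `&` D) f u) /\
  (forall b, theta0 < b -> \int[mu]_(u in [set u | b < u] `&` D) g u <=
    \int[mu]_(u in [set u | b < u] `&` D) f u).
Proof.
move=> mD fD gD L0 U0 fgL fgU between.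
have mI A : measurable A -> measurable (A `&` D) by move=> mA; exact: measurableI.
have int_f A : measurable A -> mu.-integrable (A `&` D) (EFin \o f).
  by move=> mA; apply: integrableS fD => //; exact: mI.
have int_g A : measurable A -> mu.-integrable (A `&` D) (EFin \o g).
  by move=> mA; apply: integrableS gD => //; exact: mI.
have [x [x0 Dx] fgx] := exists_ge_of_Rintegral_eq mu _ f g
  (mI _ (measurable_le theta0)) (int_f _ (measurable_le theta0))
  (int_g _ (measurable_le theta0)) L0 fgL.
have [w [w0 Dw] fgw] := exists_ge_of_Rintegral_eq mu _ f g
  (mI _ (measurable_gt theta0)) (int_f _ (measurable_gt theta0))
  (int_g _ (measurable_gt theta0)) U0 fgU.
split=> [a a0|b b0].
- apply: (le_Rintegral_crossing mu _ _ f g (mI _ (measurable_le theta0))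
    (mI _ (measurable_le a)) _ (int_f _ (measurable_le theta0))
    (int_g _ (measurable_le theta0)) fgL).
    by move=> u [/= ua Du]; split => //=; exact: le_trans ua (ltW a0).
  (* If [f <= g] at some [s] in the lower tail, then any [t] of the lower side outside the tail lies
     between [s] and the point [w] of the upper side. *)
  move=> [s [/= sa Ds] fgs] t [[/= t0 Dt] nAt].
  apply: (between s t w) => //; last exact: le_trans t0 (ltW w0).
  apply: (le_trans sa); rewrite leNgt; apply/negP => ta.
  by apply: nAt; split => //=; exact: ltW.
- apply: (le_Rintegral_crossing mu _ _ f g (mI _ (measurable_gt theta0))
    (mI _ (measurable_gt b)) _ (int_f _ (measurable_gt theta0))
    (int_g _ (measurable_gt theta0)) fgU).
    by move=> u [/= ub Du]; split => //=; exact: lt_trans b0 ub.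
  (* Symmetrically, [t] lies between the point [x] of the lower side and [s] in the upper tail. *)
  move=> [s [/= sb Ds] fgs] t [[/= t0 Dt] nAt].
  apply: (between x t s) => //; first exact: le_trans x0 (ltW t0).
  rewrite (le_trans _ (ltW sb))// leNgt; apply/negP => bt.
  by apply: nAt; split.
Qed.

(** * Posterior masses: existence of [y(n, p)] and monotonicity in [n] *)

Section posterior.
Context {R : realType}.
Context (nu : {sigma_finite_measure set (measurableTypeR R) -> \bar R}).
Context (nu_neq0 : nu setT != 0%E).
Context (mu : probability (measurableTypeR R) R).
Context (mu_conc : mu ((natural_domain nu)°) = 1%E).
Context (theta0 : R).
Context (mu_gt : (0 < mu (support_gt mu theta0) < 1)%E).
Context (weight_fin : forall (n : nat) (y : R),
  (\int[mu]_(u in msupport mu) weight nu n y u < +oo)%E).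

Local Notation dens := (tilted_density nu).

(** [D] carries all the mass of [mu], and on it [rmgf nu] is positive and log-convex; every integral
    below is reduced to [D]. *)
Local Notation D := (natural_domain nu `&` msupport mu : set (measurableTypeR R)).
Local Notation gt0 := ([set u | theta0 < u] : set (measurableTypeR R)).
Local Notation le0 := ([set u | u <= theta0] : set (measurableTypeR R)).
Local Notation U := (gt0 `&` D).
Local Notation L := (le0 `&` D).

Lemma measurable_conull : measurable D.
Proof.
by apply: measurableI; [exact: measurable_natural_domain|exact: measurable_msupport].
Qed.

Lemma measurable_gt_conull : measurable U.
Proof. exact: measurableI (measurable_gt _) measurable_conull. Qed.

Lemma measurable_le_conull : measurable L.
Proof. exact: measurableI (measurable_le _) measurable_conull. Qed.

#[local] Hint Resolve measurable_conull : core.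
#[local] Hint Resolve measurable_gt_conull measurable_le_conull : core.

Lemma measure_conullC : mu (~` D) = 0%E.
Proof.
have mN := measurable_natural_domain nu.
have N0 : mu (~` natural_domain nu) = 0%E.
  rewrite probability_setC//.
  suff -> : mu (natural_domain nu) = 1%E by rewrite subee.
  apply/eqP; rewrite eq_le probability_le1//= -mu_conc le_measure ?inE//.
    by apply: open_measurable; exact: open_interior.
  exact: interior_subset.
suff : mu.-negligible (~` D) by move/measure_negligible; apply; exact: measurableC.
rewrite setCI; apply: negligibleU.
  by exists (~` natural_domain nu); split => //; exact: measurableC.
exists (~` msupport mu); split => //; last exact: msupportC_null.
by apply: measurableC; exact: measurable_msupport.
Qed.

Lemma tilted_density_ge0 n y u : 0 <= dens n y u.
Proof.
by rewrite mulr_ge0 ?expR_ge0// invr_ge0 exprn_ge0// rmgf_ge0.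
Qed.

Lemma weight_dens n y : weight nu n y = EFin \o dens n y.
Proof. by apply/funext => u; rewrite weightE. Qed.

(** [weight_fin] bounds the integral over the support only; the complement of the support is null,
    so the bound extends to the whole line. *)
Lemma integrable_dens n y A : measurable A -> mu.-integrable A (EFin \o dens n y).
Proof.
move=> mA; apply: (@integrableS _ _ _ mu setT) => //.
have mf : measurable_fun setT (EFin \o dens n y).
  by apply/measurable_EFinP; exact: measurable_tilted_density.
apply/integrableP; split=> //.
apply: le_lt_trans (weight_fin n y); rewrite weight_dens.
have mS := measurable_msupport mu.
have -> : (\int[mu]_u `|(EFin \o dens n y) u| = \int[mu]_u (EFin \o dens n y) u)%E.
  by apply: eq_integral => u _; rewrite gee0_abs// lee_fin tilted_density_ge0.
rewrite (ge0_negligible_integral (measurableC mS))//.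
- by rewrite setTD setCK.
- by move=> u _; rewrite lee_fin tilted_density_ge0.
- exact: msupportC_null.
Qed.

Definition conull_integral n y A : R := \int[mu]_(u in A `&` D) dens n y u.

Local Notation J := conull_integral.

Lemma fine_integral_weight n y A : measurable A ->
  fine (\int[mu]_(u in A) weight nu n y u) = J n y A.
Proof.
move=> mA; rewrite weight_dens -[LHS]/(Rintegral _ _ _).
apply: Rintegral_setI_conull => //; first exact: measure_conullC.
  by apply: measurable_funTS; exact: measurable_tilted_density.
by move=> u _; exact: tilted_density_ge0.
Qed.

Lemma fine_integral_weight_msupport n y :
  fine (\int[mu]_(u in msupport mu) weight nu n y u) = J n y setT.
Proof.
rewrite fine_integral_weight; last exact: measurable_msupport.
by rewrite /conull_integral setTI setIA [X in X `&` _]setIC -setIA setIid.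
Qed.

Lemma posteriorE n y A : measurable A ->
  posterior nu mu n y A = J n y A / J n y setT.
Proof.
by move=> mA; rewrite /posterior fine_integral_weight// fine_integral_weight_msupport.
Qed.

Lemma conull_integral_setT n y :
  J n y setT = J n y [set u | theta0 < u] + J n y [set u | u <= theta0].
Proof.
rewrite /conull_integral setTI (Rintegral_setID mu D [set u | theta0 < u])//; last first.
  exact: integrable_dens.
congr (_ + _); first by rewrite setIC.
by rewrite setDE setIC; congr (Rintegral _ (_ `&` _) _);
  apply/seteqP; split => u /=; rewrite leNgt => /negP.
Qed.

Lemma measure_setI_conull A : measurable A -> mu (A `&` D) = mu A.
Proof.
move=> mA; apply/eqP; rewrite eq_le; apply/andP; split.
  by rewrite le_measure ?inE//; exact: measurableI.
have -> : (mu (A `&` D) = mu (A `&` D) + mu (~` D))%E by rewrite measure_conullC adde0.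
have mAD : measurable (A `&` D) by exact: measurableI.
have mDC : measurable (~` D) by exact: measurableC.
apply: le_trans (measureU2 mu mAD mDC).
rewrite le_measure ?inE//; first exact: measurableU.
by move=> u Au; have [Du|nDu] := pselect (D u); [left|right].
Qed.

Lemma measurable_support_gt : measurable (support_gt mu theta0 : set (measurableTypeR R)).
Proof. by apply: measurableI => //; exact: measurable_msupport. Qed.

Lemma support_gt_setI : support_gt mu theta0 `&` D = U.
Proof. by apply/seteqP; split => u [[]]; [move=> ? ? []|move=> ? []]. Qed.

Lemma post_gtE n y :
  post_gt nu mu theta0 n y = J n y [set u | theta0 < u] / J n y setT.
Proof.
rewrite /post_gt fine_integral_weight_msupport.
rewrite fine_integral_weight; last exact: measurable_support_gt.
by rewrite /conull_integral support_gt_setI.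
Qed.

Lemma measure_gt_conull_gt0 : (0 < mu U)%E.
Proof.
have mS := measurable_support_gt.
have /andP[S0 _] := mu_gt.
by rewrite -support_gt_setI measure_setI_conull.
Qed.

(** If [L] were null, [U] would carry the full mass 1 of [D], against
    [mu (support_gt mu theta0) < 1]. *)
Lemma measure_le_conull_gt0 : (0 < mu L)%E.
Proof.
have mS := measurable_support_gt.
have /andP[_ S1] := mu_gt.
rewrite lt0e measure_ge0 andbT; apply: contraTN S1 => /eqP L0.
rewrite -leNgt -(measure_setI_conull _ mS) support_gt_setI.
have <- : mu D = 1%E.
  by rewrite -[D]setTI measure_setI_conull// probability_setT.
have -> : (mu U = mu U + mu L)%E by rewrite L0 adde0.
apply: le_trans (measureU2 mu measurable_gt_conull measurable_le_conull).
rewrite le_measure ?inE//; first exact: measurableU.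
by move=> u Du; have [?|?] := ltP theta0 u; [left|right].
Qed.

#[local] Hint Resolve measure_gt_conull_gt0 measure_le_conull_gt0 : core.

Lemma conull_integral_gt0 n y A : measurable A -> (0 < mu (A `&` D))%E -> 0 < J n y A.
Proof.
move=> mA A0; have mAD : measurable (A `&` D) by exact: measurableI.
apply: Rintegral_gt0 => //; first exact: integrable_dens.
by move=> u [_ [Nu _]]; exact: tilted_density_gt0.
Qed.

Lemma conull_integral_setT_gt0 n y : 0 < J n y setT.
Proof. by rewrite conull_integral_setT addr_gt0// conull_integral_gt0. Qed.

Lemma conull_integral_le_div n y : J n y le0 / J n y setT = 1 - J n y gt0 / J n y setT.
Proof.
have := conull_integral_setT_gt0 n y; rewrite conull_integral_setT.
move: (J n y gt0) (J n y le0) => v w vw0.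
by rewrite -[1](divff (lt0r_neq0 vw0)) -mulrBl addrAC subrr add0r.
Qed.

Lemma exists_post_gt n p : 0 < p < 1 -> exists y, post_gt nu mu theta0 n y = p.
Proof.
move=> p01.
pose rho u := rmgf nu u ^- n.
(* Recentring the exponent at [theta0] makes it positive on [U] and nonpositive on [L], at the cost
   of a factor common to both sides, which cancels at the end. *)
have tiltE y u : expR ((u - theta0) * y) * rho u = expR (- (theta0 * y)) * dens n y u.
  by rewrite /dens mulrBl expRD mulrCA mulrA.
have int y A : measurable A ->
    mu.-integrable A (EFin \o (fun u => expR ((u - theta0) * y) * rho u)).
  move=> mA; rewrite (_ : _ \o _ =
      (fun u => ((expR (- (theta0 * y)))%:E * (EFin \o dens n y) u)%E)).
    by apply: integrableZl => //; exact: integrable_dens.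
  by apply/funext => u; rewrite /= tiltE EFinM.
have tiltJ y A : measurable A ->
    tilt mu (fun u => u - theta0) rho (A `&` D) y = expR (- (theta0 * y)) * J n y A.
  move=> mA; rewrite /tilt; under eq_Rintegral do rewrite tiltE.
  rewrite RintegralZl//; first exact: measurableI.
  by apply: integrable_dens; exact: measurableI.
have rho0 u : 0 <= rho u.
  by have := tilted_density_ge0 n 0 u; rewrite /tilted_density mulr0 expR0 mul1r.
have [||||||||y] := exists_tilt_ratio mu (fun u => u - theta0) rho U L p
   measurable_gt_conull measurable_le_conull _ _ _ _ _ _ _ _ p01.
- by move=> *.
- by move=> *.
- by move=> y; exact: int.
- by move=> y; exact: int.
- by move=> u [? _]; rewrite subr_gt0.
- by move=> u [? _]; rewrite subr_le0.
- by rewrite tiltJ// mulr_gt0 ?expR_gt0// conull_integral_gt0.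
- by rewrite tiltJ// mulr_gt0 ?expR_gt0// conull_integral_gt0.
rewrite !tiltJ// mulrCA [RHS]mulrCA => /(mulfI (lt0r_neq0 (expR_gt0 _))) e.
exists y; rewrite post_gtE; apply: (canLR (mulfK _)).
  by rewrite gt_eqF// conull_integral_setT_gt0.
by rewrite conull_integral_setT mulrDr -e -mulrDl subrKC mul1r.
Qed.

(** The normalised densities have mass [p] on [U], hence [1 - p] on [L], and they satisfy the
    interval property on [D]; the tail comparison then applies. *)
Lemma posterior_le_of_post_gt m n y z p : (m <= n)%N ->
  post_gt nu mu theta0 m y = p -> post_gt nu mu theta0 n z = p ->
  (forall a, a < theta0 ->
    posterior nu mu n z [set t | t <= a] <= posterior nu mu m y [set t | t <= a]) /\
  (forall b, theta0 < b ->
    posterior nu mu n z [set t | b < t] <= posterior nu mu m y [set t | b < t]).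
Proof.
move=> mn; rewrite !post_gtE => py pz.
pose f u := dens m y u / J m y setT; pose g u := dens n z u / J n z setT.
have Jf A : measurable A -> \int[mu]_(u in A `&` D) f u = J m y A / J m y setT.
  move=> mA; rewrite /f RintegralZr//; first exact: measurableI.
  by apply: integrable_dens; exact: measurableI.
have Jg A : measurable A -> \int[mu]_(u in A `&` D) g u = J n z A / J n z setT.
  move=> mA; rewrite /g RintegralZr//; first exact: measurableI.
  by apply: integrable_dens; exact: measurableI.
have int_f A : measurable A -> mu.-integrable A (EFin \o f).
  by move=> mA; exact: (integrableZr mA _ (integrable_dens m y A mA)).
have int_g A : measurable A -> mu.-integrable A (EFin \o g).
  by move=> mA; exact: (integrableZr mA _ (integrable_dens n z A mA)).
have fgU : \int[mu]_(u in U) f u = \int[mu]_(u in U) g u.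
  by rewrite (Jf _ (measurable_gt theta0)) (Jg _ (measurable_gt theta0)) py pz.
have fgL : \int[mu]_(u in L) f u = \int[mu]_(u in L) g u.
  rewrite (Jf _ (measurable_le theta0)) (Jg _ (measurable_le theta0)).
  by rewrite (conull_integral_le_div m y) (conull_integral_le_div n z) py pz.
have between s t r : D s -> D r ->
    s <= t -> t <= r -> f s <= g s -> f r <= g r -> f t <= g t.
  move=> [Ns _] [Nr _] st tr.
  exact: (le_tilted_density_between nu nu_neq0 m n y z _ _ _ _ _ mn
    (conull_integral_setT_gt0 m y) (conull_integral_setT_gt0 n z) Ns Nr st tr).
have [le_tail gt_tail] := le_Rintegral_tails mu D f g theta0 measurable_conull
  (int_f _ measurable_conull) (int_g _ measurable_conull) measure_le_conull_gt0
  measure_gt_conull_gt0 fgL fgU between.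
split=> [a a0|b b0].
- rewrite (posteriorE n z _ (measurable_le a)) (posteriorE m y _ (measurable_le a)).
  by rewrite -(Jf _ (measurable_le a)) -(Jg _ (measurable_le a)) le_tail.
- rewrite (posteriorE n z _ (measurable_gt b)) (posteriorE m y _ (measurable_gt b)).
  by rewrite -(Jf _ (measurable_gt b)) -(Jg _ (measurable_gt b)) gt_tail.
Qed.

End posterior.

Theorem theorem4p1 (R : realType)
  (nu : {sigma_finite_measure set (measurableTypeR R) -> \bar R})
  (nu_neq0 : nu setT != 0%E)
  (mu : probability (measurableTypeR R) R)
  (mu_conc : mu ((natural_domain nu)°) = 1%E)
  (theta0 : R)
  (mu_gt : (0 < mu (support_gt mu theta0) < 1)%E)
  (weight_fin : forall (n : nat) (y : R),
     (\int[mu]_(u in msupport mu) weight nu n y u < +oo)%E)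
  (a b p : R) (ha : a < theta0) (hb : theta0 < b) (hpi : 0 < p < 1) :
  nonincreasing_seq
    (fun n : nat => prob_Theta nu mu theta0 n p [set t | t <= a]) /\
  nonincreasing_seq
    (fun n : nat => prob_Theta nu mu theta0 n p [set t | b < t]).
Proof.
(* A solution exists because [0 < p < 1], so [xget] returns one and not its default 0. *)
have y_ofP n : post_gt nu mu theta0 n (y_of nu mu theta0 n p) = p.
  apply: (@xgetPex _ 0 [set y | post_gt nu mu theta0 n y = p]).
  exact: exists_post_gt.
have mono m n (mn : (m <= n)%N) := posterior_le_of_post_gt nu nu_neq0 mu mu_conc
  theta0 mu_gt weight_fin m n _ _ p mn (y_ofP m) (y_ofP n).
by split=> m n mn; have [le_a le_b] := mono m n mn; [exact: le_a|exact: le_b].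
Qed.
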